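(* Let $\kappa,\beta>0$, let $V:\mathbb{R}^2\to\mathbb{R}$, $V=V(p,q)$, be smooth, and let $f:\mathbb{C}\to\mathbb{C}$ be given by $\mathrm{Re}\, f(p+iq)=\frac{\partial V}{\partial p}(p,q)$, $\mathrm{Im}\, f(p+iq)=\frac{\partial V}{\partial q}(p,q)$. Then the two-dimensional equation $$\kappa u_{tt}+iu_t+\beta(u_{xx}+u_{yy})+f(u)=0,\qquad u=u(x,y,t)\in\mathbb{C},$$ is multi-symplectic: writing $u=p+iq$, $p_t=\phi$, $q_t=\varphi$, $p_x=v_1$, $q_x=w_1$, $p_y=v_2$, $q_y=w_2$ and $z=(p,q,v_1,w_1,v_2,w_2,\phi,\varphi)^T\in\mathbb{R}^8$, it is equivalent (for smooth $u$) to the system $$\mathbb{K}z_t+\mathbb{M}_1z_x+\mathbb{M}_2z_y=\nabla_z\mathfrak{S}(z),$$ $$\mathfrak{S}(z)=V(p,q)+\beta\left(\frac{v_1^2+w_1^2}{2}+\frac{v_2^2+w_2^2}{2}\right)+\kappa\,\frac{\phi^2+\varphi^2}{2},$$ where $\mathbb{K},\mathbb{M}_1,\mathbb{M}_2$ are the real skew-symmetric $8\times8$ matrices whose only nonzero entries are $$\mathbb{K}_{12}=1,\ \mathbb{K}_{21}=-1,\ \mathbb{K}_{17}=\mathbb{K}_{28}=-\kappa,\ \mathbb{K}_{71}=\mathbb{K}_{82}=\kappa,$$ $$(\mathbb{M}_1)_{13}=(\mathbb{M}_1)_{24}=-\beta,\ (\mathbb{M}_1)_{31}=(\mathbb{M}_1)_{42}=\beta,$$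 $$(\mathbb{M}_2)_{15}=(\mathbb{M}_2)_{26}=-\beta,\ (\mathbb{M}_2)_{51}=(\mathbb{M}_2)_{62}=\beta.$$ Moreover, the multi-symplectic conservation law $$\partial_t\,\omega(U,W)+\partial_x\,k_1(U,W)+\partial_y\,k_2(U,W)=0$$ holds for any smooth solution $z$ of this system and any two smooth solutions $U,W$ of the associated variational equation $\mathbb{K}Z_t+\mathbb{M}_1Z_x+\mathbb{M}_2Z_y=\mathfrak{S}''(z)Z$, where $$\omega=dp\wedge dq-\kappa(dp\wedge d\phi+dq\wedge d\varphi),\qquad k_j=-\beta(dp\wedge dv_j+dq\wedge dw_j),\quad j=1,2.$$
   Context: $\nabla_z$ is the gradient in $\mathbb{R}^8$ and $\mathfrak{S}''(z)$ is the Hessian matrix of $\mathfrak{S}$ at $z$. For vectors $U,W\in\mathbb{R}^8$ with components indexed by $(p,q,v_1,w_1,v_2,w_2,\phi,\varphi)$, and coordinates $a,b$ among these, $(da\wedge db)(U,W)=U_aW_b-U_bW_a$. *)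

(* Defs.v *)
From mathcomp Require Import all_boot all_order all_algebra.
From mathcomp Require Import all_classical all_reals all_analysis.
From mathcomp Require Import complex.
Import Order.TTheory GRing.Theory Num.Theory numFieldNormedType.Exports.

Set Implicit Arguments.
Unset Strict Implicit.
Unset Printing Implicit Defensive.

Local Open Scope classical_set_scope.
Local Open Scope ring_scope.

Section Calculus.
Context {R : realType}.

(* Like 'D_v, this is a total operator; it is meaningful where the limit
   exists, which smooth_on guarantees. *)
Definition pd n (W : normedModType R) (i : 'I_n) (g : 'cV[R]_n -> W) :
  'cV[R]_n -> W := fun x => 'D_(delta_mx i 0) g x.

(* C^oo on an open set A: partial derivatives of all orders exist and are
   continuous at every point of A. *)
Definition smooth_on n (W : normedModType R) (A : set 'cV[R]_n)
    (g : 'cV[R]_n -> W) : Prop :=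
  forall (s : seq 'I_n) (x : 'cV[R]_n), A x ->
    {for x, continuous (foldr (@pd n W) g s)} /\
    forall i : 'I_n, derivable (foldr (@pd n W) g s) x (delta_mx i 0).

Definition gradient n (S : 'cV[R]_n -> R) (z : 'cV[R]_n) : 'cV[R]_n :=
  \col_i pd i S z.

Definition hessian n (S : 'cV[R]_n -> R) (z : 'cV[R]_n) : 'M[R]_n :=
  \matrix_(i, j) pd i (pd j S) z.

(* Derivative in a real variable of a complex-valued function, componentwise:
   R[i] carries no normed R-module structure. *)
Definition cpd n (i : 'I_n) (u : 'cV[R]_n -> R[i]) : 'cV[R]_n -> R[i] :=
  fun x => Complex (pd i (fun y => complex.Re (u y)) x) (pd i (fun y => complex.Im (u y)) x).

Definition csmooth_on n (A : set 'cV[R]_n) (u : 'cV[R]_n -> R[i]) : Prop :=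
  smooth_on A (fun x => complex.Re (u x)) /\ smooth_on A (fun x => complex.Im (u x)).

Definition pt2 (p q : R) : 'cV[R]_2 := \col_i nth 0 [:: p; q] i.

End Calculus.

(* Coordinates (p, q) of R^2 and (x, y, t) of space-time. *)
Definition ip : 'I_2 := @Ordinal 2 0 isT.
Definition iq : 'I_2 := @Ordinal 2 1 isT.

Definition ix : 'I_3 := @Ordinal 3 0 isT.
Definition iy : 'I_3 := @Ordinal 3 1 isT.
Definition it : 'I_3 := @Ordinal 3 2 isT.

(* Coordinates (p, q, v1, w1, v2, w2, phi, varphi) of R^8. *)
Definition jp : 'I_8 := @Ordinal 8 0 isT.
Definition jq : 'I_8 := @Ordinal 8 1 isT.
Definition jv1 : 'I_8 := @Ordinal 8 2 isT.
Definition jw1 : 'I_8 := @Ordinal 8 3 isT.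
Definition jv2 : 'I_8 := @Ordinal 8 4 isT.
Definition jw2 : 'I_8 := @Ordinal 8 5 isT.
Definition jphi : 'I_8 := @Ordinal 8 6 isT.
Definition jvarphi : 'I_8 := @Ordinal 8 7 isT.

Section WaveSchrodinger.
Context {R : realType}.
Implicit Types (kappa beta : R) (A : set 'cV[R]_3).

Definition solves_pde kappa beta (f : R[i] -> R[i]) A
    (u : 'cV[R]_3 -> R[i]) : Prop :=
  forall P, A P ->
    (kappa%:C * cpd it (cpd it u) P + 'i * cpd it u P
     + beta%:C * (cpd ix (cpd ix u) P + cpd iy (cpd iy u) P) + f (u P))%C = 0.

Definition zlift (u : 'cV[R]_3 -> R[i]) : 'cV[R]_3 -> 'cV[R]_8 :=
  let p := fun P => complex.Re (u P) in
  let q := fun P => complex.Im (u P) in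
  fun P => \col_i nth 0
    [:: p P; q P; pd ix p P; pd ix q P; pd iy p P; pd iy q P;
        pd it p P; pd it q P] i.

(* Row and column numbers below are 1-based, while ordinals are 0-based. *)
Definition Kmx kappa : 'M[R]_8 := \matrix_(i < 8, j < 8)
  match i.+1, j.+1 with
  | 1%N, 2%N => 1
  | 2%N, 1%N => -1
  | 1%N, 7%N | 2%N, 8%N => - kappa
  | 7%N, 1%N | 8%N, 2%N => kappa
  | _, _ => 0
  end.

Definition M1mx beta : 'M[R]_8 := \matrix_(i < 8, j < 8)
  match i.+1, j.+1 with
  | 1%N, 3%N | 2%N, 4%N => - beta
  | 3%N, 1%N | 4%N, 2%N => beta
  | _, _ => 0
  end.

Definition M2mx beta : 'M[R]_8 := \matrix_(i < 8, j < 8)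
  match i.+1, j.+1 with
  | 1%N, 5%N | 2%N, 6%N => - beta
  | 5%N, 1%N | 6%N, 2%N => beta
  | _, _ => 0
  end.

Definition Sfun kappa beta (V : 'cV[R]_2 -> R) (z : 'cV[R]_8) : R :=
  V (pt2 (z jp 0) (z jq 0))
  + beta * ((z jv1 0 ^+ 2 + z jw1 0 ^+ 2) / 2
            + (z jv2 0 ^+ 2 + z jw2 0 ^+ 2) / 2)
  + kappa * ((z jphi 0 ^+ 2 + z jvarphi 0 ^+ 2) / 2).

Definition solves_ms (K M1 M2 : 'M[R]_8) (S : 'cV[R]_8 -> R) A
    (z : 'cV[R]_3 -> 'cV[R]_8) : Prop :=
  forall P, A P ->
    K *m pd it z P + M1 *m pd ix z P + M2 *m pd iy z P = gradient S (z P).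

Definition solves_variational (K M1 M2 : 'M[R]_8) (S : 'cV[R]_8 -> R) A
    (z Z : 'cV[R]_3 -> 'cV[R]_8) : Prop :=
  forall P, A P ->
    K *m pd it Z P + M1 *m pd ix Z P + M2 *m pd iy Z P
    = hessian S (z P) *m Z P.

(* (da /\ db)(U, W) *)
Definition dwedge (a b : 'I_8) (U W : 'cV[R]_8) : R :=
  U a 0 * W b 0 - U b 0 * W a 0.

Definition omega kappa (U W : 'cV[R]_8) : R :=
  dwedge jp jq U W - kappa * (dwedge jp jphi U W + dwedge jq jvarphi U W).

Definition k1 beta (U W : 'cV[R]_8) : R :=
  - beta * (dwedge jp jv1 U W + dwedge jq jw1 U W).

Definition k2 beta (U W : 'cV[R]_8) : R :=
  - beta * (dwedge jp jv2 U W + dwedge jq jw2 U W).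

End WaveSchrodinger.

(* Main.v *)
Require Import Defs.
From mathcomp Require Import all_boot all_order all_algebra.
From mathcomp Require Import all_classical all_reals all_analysis.
From mathcomp Require Import complex ring lra.
Import Order.TTheory GRing.Theory Num.Theory numFieldNormedType.Exports.

(** Read row by row, the first two equations of the first-order system are the
real and imaginary parts of the wave equation, and the remaining six, in which
[beta] and [kappa] cancel, say that the last six components of [z] are the
first derivatives of [p] and [q] ([ms_rows]).  Hence [zlift u] solves the system
exactly when [u] solves the equation ([pde_iff_ms]), and every solution [z] is
the lift of [z_p + i z_q] ([ms_eq_zlift]).

For the conservation law, [omega], [k1] and [k2] are the bilinear forms
[U^T M W] of the three skew-symmetric matrices.  By the product rule and skewness,
the derivative of [U^T M W] in the direction that belongs to [M] is
[U^T (M W') - (M U')^T W]; summing over the three directions and using the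
variational equation gives [U^T H W - (H U)^T W], where [H] is the Hessian.  This
vanishes because [H] is symmetric ([multisymplectic_conservation]).

Symmetry of the Hessian needs an argument, since smoothness is expressed by
partial derivatives only: the off-diagonal entries are mixed second derivatives
of [V], which agree by the theorem of Schwarz ([Schwarz]).  The composite of [V]
with the projection to the [(p, q)] plane is differentiated without a chain
rule: a linear map sends lines to lines, so the difference quotients coincide
([is_derive_on_line]). *)

Set Implicit Arguments.
Unset Strict Implicit.
Unset Printing Implicit Defensive.

Local Open Scope classical_set_scope.
Local Open Scope ring_scope.

(** * Symmetry of second derivatives *)

(** A directional derivative depends only on the values along one line, so it
transfers between functions on different spaces; restriction to a line,
translation and composition with a linear map are all instances. *)
Lemma is_derive_on_line (R : realType) (E F W : normedModType R)
    (f : E -> W) (g : F -> W) (a v : E) (b w : F) :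
  (forall h : R, g (h *: w + b) = f (h *: v + a)) ->
  derivable f a v -> is_derive b w g ('D_v f a).
Proof.
move=> gf df.
have quotE : (fun h : R => h^-1 *: ((f \o shift a) (h *: v) - f a))
    = (fun h : R => h^-1 *: ((g \o shift b) (h *: w) - g b)).
  apply/funext => h /=; rewrite gf; congr (_ *: (_ - _)).
  by have := gf 0; rewrite !scale0r !add0r.
by apply: DeriveDef; rewrite /derivable /derive -quotE.
Qed.

Section Schwarz.
Context {R : realType} {E : normedModType R}.
Implicit Types (f : E -> R) (x y u v : E).

Lemma MVT_line f x v (h : R) : 0 < h -> (forall y, derivable f y v) ->
  exists2 c, 0 < c < h & f (h *: v + x) - f x = h * 'D_v f (c *: v + x).
Proof.
move=> h0 df; pose g (r : R) := f (r *: v + x).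
have dg (s : R) : is_derive s 1 g ('D_v f (s *: v + x)).
  apply: is_derive_on_line => // k.
  by rewrite /g [k%:A]mulr1 scalerDl addrA.
have cg : {within `[0, h], continuous g}.
  apply: continuous_subspaceT => s.
  by apply/differentiable_continuous/derivable1_diffP; case: (dg s).
have [c chI] := MVT h0 (fun s _ => dg s) cg.
rewrite /g scale0r add0r subr0 mulrC => ->; exists c => //.
Qed.

(** Two applications of the mean value theorem: to the increment of [f] in the
direction [v], seen as a function along [u], and then to ['D_u f] along [v].
The left-hand side is symmetric in [u] and [v], which is what makes
[Schwarz] work. *)
Lemma second_difference f u v x (h : R) : 0 < h ->
  (forall y, derivable f y u) -> (forall y, derivable ('D_u f) y v) ->
  exists c d, [/\ 0 < c < h, 0 < d < h &
    f (h *: v + (h *: u + x)) - f (h *: u + x) - (f (h *: v + x) - f x)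
      = h * (h * 'D_v ('D_u f) (d *: v + (c *: u + x)))].
Proof.
move=> h0 df ddf; pose g y := f (h *: v + y) - f y.
have dg y : is_derive y u g ('D_u f (h *: v + y) - 'D_u f y).
  apply: is_deriveB; last exact: derivableP.
  by apply: is_derive_on_line => // k; rewrite addrCA.
have [|c cI] := @MVT_line g x u h h0; first by move=> y; case: (dg y).
have [d dI] := @MVT_line ('D_u f) (c *: u + x) v h h0 ddf.
by rewrite (@derive_val _ _ _ _ _ _ _ (dg _)) => -> gE; exists c, d.
Qed.

Lemma small_parallelogram u v (r : R) : 0 < r -> exists2 h : R, 0 < h &
  forall a b, 0 < a < h -> 0 < b < h -> `|a *: u + b *: v| < r.
Proof.
move=> r0; have n0 : 0 < `|u| + `|v| + 1 by rewrite ltr_wpDl// addr_ge0.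
exists (r / (`|u| + `|v| + 1)); first exact: divr_gt0.
set h := r / _ => a b /andP[a0 ah] /andP[b0 bh].
rewrite (le_lt_trans (ler_normD _ _))// !normrZ !gtr0_norm//.
(* The summand 1 in the denominator makes the bound strict. *)
have -> : r = h * `|u| + h * `|v| + h.
  by rewrite -mulrDr -{2}[h]mulr1 -mulrDr divfK// gt_eqF.
by rewrite ltr_pwDr ?divr_gt0// lerD// ler_wpM2r// ltW.
Qed.

(** Up to the factor [h * h], the second difference of [f] is at once a value of
['D_v ('D_u f)] and a value of ['D_u ('D_v f)], at points that tend to [x] with
[h]. *)
Theorem Schwarz f x u v :
  (forall y, derivable f y u) -> (forall y, derivable f y v) ->
  (forall y, derivable ('D_u f) y v) -> (forall y, derivable ('D_v f) y u) ->
  {for x, continuous ('D_v ('D_u f))} -> {for x, continuous ('D_u ('D_v f))} ->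
  'D_v ('D_u f) x = 'D_u ('D_v f) x.
Proof.
move=> dfu dfv ddfu ddfv cuv cvu.
apply/eqP; rewrite -subr_eq0 -normr_le0; apply/ler_addgt0Pr => e e0.
have e20 : 0 < e / 2 by rewrite divr_gt0.
have close (p q m : R) : `|p - m| < e / 2 -> `|q - m| < e / 2 ->
    `|p - q| <= 0 + e.
  move=> pm qm; rewrite add0r (splitr e) (le_trans (ler_distD m p q))//.
  by rewrite lerD// ltW// distrC.
have /cvgrPdist_lt/(_ _ e20)/nbhs_ballP[r1 /= r10 near1] := cuv.
have /cvgrPdist_lt/(_ _ e20)/nbhs_ballP[r2 /= r20 near2] := cvu.
have r0 : 0 < Num.min r1 r2 by rewrite lt_min r10.
have [h h0 small] := small_parallelogram u v r0.
have [c [d [cI dI E1]]] := second_difference x h0 dfu ddfu.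
have [c' [d' [c'I d'I E2]]] := second_difference x h0 dfv ddfv.
have E12 : 'D_v ('D_u f) (d *: v + (c *: u + x))
         = 'D_u ('D_v f) (d' *: u + (c' *: v + x)).
  apply: (mulfI (lt0r_neq0 h0)); apply: (mulfI (lt0r_neq0 h0)).
  have swap (p q r s : R) : p - q - (r - s) = p - r - (q - s) by ring.
  apply: etrans (esym E1) (etrans _ E2).
  by rewrite [h *: v + (h *: u + x)]addrCA; apply: swap.
have inball (a b r : R) : 0 < a < h -> 0 < b < h -> Num.min r1 r2 <= r ->
    ball x r (a *: u + b *: v + x).
  move=> aI bI rmin; rewrite -ball_normE /= distrC addrK.
  exact: lt_le_trans (small _ _ aI bI) rmin.
have b1 : `|'D_v ('D_u f) x - 'D_v ('D_u f) (d *: v + (c *: u + x))| < e / 2.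
  have -> : d *: v + (c *: u + x) = c *: u + d *: v + x by rewrite addrCA addrA.
  by apply: (near1 _ (inball _ _ _ cI dI _)); rewrite ge_min lexx.
have b2 : `|'D_u ('D_v f) x - 'D_u ('D_v f) (d' *: u + (c' *: v + x))| < e / 2.
  rewrite addrA.
  by apply: (near2 _ (inball _ _ _ d'I c'I _)); rewrite ge_min lexx orbT.
by apply: close b1 _; rewrite E12; exact: b2.
Qed.

End Schwarz.

(** * Smoothness and coordinates *)

Section Smooth.
Context {R : realType}.

Lemma smooth_on_derivable n (W : normedModType R) (A : set 'cV[R]_n)
    (g : 'cV[R]_n -> W) i x :
  smooth_on A g -> A x -> derivable g x (delta_mx i 0).
Proof. by move=> sg Ax; case: (sg [::] x Ax). Qed.

Lemma smooth_on_continuous n (W : normedModType R) (A : set 'cV[R]_n)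
    (g : 'cV[R]_n -> W) x :
  smooth_on A g -> A x -> {for x, continuous g}.
Proof. by move=> sg Ax; case: (sg [::] x Ax). Qed.

Lemma smooth_on_pd n (W : normedModType R) (A : set 'cV[R]_n)
    (g : 'cV[R]_n -> W) i :
  smooth_on A g -> smooth_on A (pd i g).
Proof. by move=> sg s x Ax; have := sg (rcons s i) x Ax; rewrite foldr_rcons. Qed.

Lemma eq_on_pd n (W : normedModType R) (A : set 'cV[R]_n)
    (g1 g2 : 'cV[R]_n -> W) i x : open A -> A x ->
  (forall y, A y -> g1 y = g2 y) -> pd i g1 x = pd i g2 x.
Proof.
move=> oA Ax g12; apply: near_eq_derive.
by apply: filterS (open_nbhs_nbhs (conj oA Ax)) => y /g12.
Qed.

Section Coordinates.
Context {n m : nat}.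
Implicit Types (g : 'cV[R]_n -> 'cV[R]_m).

Lemma pd_coord g i j x : derivable g x (delta_mx i 0) ->
  pd i g x j 0 = pd i (fun y => g y j 0) x.
Proof. by move=> dg; rewrite /pd derive_mx// mxE. Qed.

(** Iterated partial derivatives of a coordinate and coordinates of iterated
partial derivatives agree on [A] only, because the operators take unspecified
values where no limit exists; openness of [A] carries this agreement to
neighbourhoods, hence to the next derivative. *)
Lemma smooth_on_coord (A : set 'cV[R]_n) g j : open A ->
  smooth_on A g -> smooth_on A (fun x => g x j 0).
Proof.
move=> oA sg s x Ax.
have eqA y : A y -> foldr (@pd R n 'cV[R]_m) g s y j 0
    = foldr (@pd R n R) (fun x => g x j 0) s y.
  elim: s y => [|i s IH] y Ay //=.
  rewrite pd_coord; last by case: (sg s y Ay).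
  exact: (eq_on_pd _ oA Ay).
set Gj := foldr _ (fun x => g x j 0) s in eqA *.
set G := foldr _ g s in eqA.
have nearA : {near x, (fun y => G y j 0) =1 Gj}.
  by apply: filterS (open_nbhs_nbhs (conj oA Ax)) => y /eqA.
have [cs ds] := sg s x Ax; split=> [|i].
  rewrite /prop_for /continuous_at -(eqA x Ax).
  have cj : (fun y => G y j 0) @ x --> G x j 0.
    exact: continuous_comp cs (@coord_continuous R m 1 j 0 _).
  exact: cvg_trans (near_eq_cvg nearA) cj.
by apply: near_eq_derivable nearA _; have /derivable_mxP := ds i.
Qed.
End Coordinates.
End Smooth.

(** * Conservation laws of skew-symmetric systems *)

Section Conservation.
Context {R : realType}.

Lemma is_derive_mulmx (E : normedModType R) m n p (F : E -> 'M[R]_(m, n))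
    (G : E -> 'M[R]_(n, p)) dF dG x v :
  is_derive x v F dF -> is_derive x v G dG ->
  is_derive x v (fun y => F y *m G y) (dF *m G x + F x *m dG).
Proof.
move=> [dF1 dF2] [dG1 dG2].
have dij i j : is_derive x v (fun y => (F y *m G y) i j)
    ((dF *m G x + F x *m dG) i j).
  have -> : (fun y => (F y *m G y) i j)
      = \sum_k ((fun y => F y i k) * (fun y => G y k j)).
    by apply/funext => y; rewrite mxE fct_sumE.
  rewrite -dF2 -dG2 (derive_mx dF1) (derive_mx dG1) !mxE -big_split/=.
  apply: is_derive_sum => k; rewrite !mxE addrC [X in _ + X]mulrC.
  by apply: is_deriveM; apply: derivableP;
    [have /derivable_mxP := dF1|have /derivable_mxP := dG1].
have dFG : derivable (fun y => F y *m G y) x v.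
  by apply/derivable_mxP => i j; case: (dij i j).
apply: (DeriveDef dFG); rewrite (derive_mx dFG).
by apply/matrixP => i j; rewrite mxE; case: (dij i j).
Qed.

Lemma pd_bilinear n m (M : 'M[R]_m) (U W : 'cV[R]_n -> 'cV[R]_m) i x :
  derivable U x (delta_mx i 0) -> derivable W x (delta_mx i 0) ->
  pd i (fun y => ((U y)^T *m M *m W y) 0 0) x
    = ((pd i U x)^T *m M *m W x + (U x)^T *m M *m pd i W x) 0 0.
Proof.
move=> dU dW.
have trE a b : (fun y => (U y)^T a b) = (fun y => U y b a).
  by apply/funext => y; rewrite mxE.
have dT : derivable (fun y => (U y)^T) x (delta_mx i 0).
  by apply/derivable_mxP => a b; rewrite trE; have /derivable_mxP := dU.
have dUT : is_derive x (delta_mx i 0) (fun y => (U y)^T) (pd i U x)^T.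
  apply: (DeriveDef dT); rewrite /pd (derive_mx dT) (derive_mx dU).
  by apply/matrixP => a b; rewrite 3!mxE trE.
have dUM := is_derive_mulmx dUT (is_derive_cst M x (delta_mx i 0)).
have [dUMW eUMW] := is_derive_mulmx dUM (derivableP dW).
rewrite /pd; move: eUMW; rewrite (derive_mx dUMW) => /matrixP/(_ 0 0).
by rewrite mxE => ->; rewrite mulmx0 addr0.
Qed.

(** Skewness turns [(pd i U)^T M] into [- (M pd i U)^T], so that the first half
of the product rule sums to [- (H U)^T W] and the second half to [U^T H W]. *)
Theorem multisymplectic_conservation n m (M : 'I_n -> 'M[R]_m) (H : 'M[R]_m)
    (U W : 'cV[R]_n -> 'cV[R]_m) x :
  (forall i, (M i)^T = - M i) -> H^T = H ->
  (forall i, derivable U x (delta_mx i 0)) ->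
  (forall i, derivable W x (delta_mx i 0)) ->
  \sum_i M i *m pd i U x = H *m U x ->
  \sum_i M i *m pd i W x = H *m W x ->
  \sum_i pd i (fun y => ((U y)^T *m M i *m W y) 0 0) x = 0.
Proof.
move=> skewM symH dU dW HU HW.
have sumU : \sum_i (pd i U x)^T *m M i *m W x = - ((U x)^T *m H *m W x).
  rewrite -mulmx_suml -mulNmx -[X in X *m _]trmxK raddf_sum/=.
  under eq_bigr do rewrite trmx_mul trmxK skewM mulNmx.
  by rewrite sumrN HU raddfN/= trmx_mul symH.
have sumW : \sum_i (U x)^T *m M i *m pd i W x = (U x)^T *m H *m W x.
  under eq_bigr do rewrite -mulmxA.
  by rewrite -mulmx_sumr HW mulmxA.
under eq_bigr do rewrite pd_bilinear// mxE.
by rewrite big_split/= -!summxE sumU sumW mxE addNr.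
Qed.
End Conservation.

(** * The Hamiltonian *)

Lemma sum_coord8 (G : zmodType) (F : 'I_8 -> G) :
  \sum_i F i = F jp + F jq + F jv1 + F jw1 + F jv2 + F jw2 + F jphi + F jvarphi.
Proof.
rewrite !big_ord_recl big_ord0 addr0 !addrA.
by do 7?congr (_ + _); congr (F _); apply: val_inj.
Qed.

Lemma sum_coord3 (G : zmodType) (F : 'I_3 -> G) :
  \sum_i F i = F ix + F iy + F it.
Proof.
rewrite !big_ord_recl big_ord0 addr0 !addrA.
by do 2?congr (_ + _); congr (F _); apply: val_inj.
Qed.

Lemma coord8_ind (P : 'I_8 -> Prop) :
  P jp -> P jq -> P jv1 -> P jw1 -> P jv2 -> P jw2 -> P jphi -> P jvarphi ->
  forall i, P i.
Proof.
move=> ? ? ? ? ? ? ? ? i.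
have : i \in [:: jp; jq; jv1; jw1; jv2; jw2; jphi; jvarphi].
  by case: i => -[|[|[|[|[|[|[|[|//]]]]]]]].
by rewrite !inE; do 7?[case/predU1P => [-> //|]]; move/eqP->.
Qed.

Lemma smooth_on_cst0 (R : realType) n (W : normedModType R) (A : set 'cV[R]_n) :
  smooth_on A (cst 0 : 'cV[R]_n -> W).
Proof.
move=> s x Ax.
have -> : foldr (@pd R n W) (cst 0) s = cst 0.
  elim: s => //= i s ->; apply/funext => y; exact: derive_cst.
by split=> [|i]; [exact: cst_continuous|exact: derivable_cst].
Qed.

Section Hamiltonian.
Context {R : realType}.
Variables (kappa beta : R) (V : 'cV[R]_2 -> R).
Hypothesis hV : smooth_on setT V.

Definition proj_pq (z : 'cV[R]_8) : 'cV[R]_2 := pt2 (z jp 0) (z jq 0).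

(** The coefficients of the quadratic part of the Hamiltonian. *)
Definition weight (i : 'I_8) : R :=
  nth 0 [:: 0; 0; beta; beta; beta; beta; kappa; kappa] i.

Local Notation dir i := (proj_pq (delta_mx i 0)).

Lemma proj_pq_delta i : dir i =
  if i == jp then delta_mx ip 0 else if i == jq then delta_mx iq 0 else 0.
Proof.
apply/colP => k; rewrite /proj_pq !mxE.
by case: i k => -[|[|i]] lti [[|[|k]] ltk] //=; rewrite ?mxE.
Qed.

Lemma proj_pq_line (h : R) (v z : 'cV[R]_8) :
  proj_pq (h *: v + z) = h *: proj_pq v + proj_pq z.
Proof.
by apply/colP => -[[|[|k]] ltk] //; rewrite !mxE.
Qed.

Lemma Sfun_quadratic z : Sfun kappa beta V z =
  V (proj_pq z) + \sum_i weight i / 2 * z i 0 ^+ 2.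
Proof. by rewrite /Sfun sum_coord8 /weight /= -/(proj_pq z); lra. Qed.

Lemma is_derive_coord i j (z : 'cV[R]_8) :
  is_derive z (delta_mx j 0) (fun z : 'cV[R]_8 => z i 0) (i == j)%:R.
Proof.
rewrite -[(i == j)%:R](derive_id (z i 0)).
apply: is_derive_on_line; last exact: derivable_id.
by move=> h; rewrite !mxE eqxx andbT.
Qed.

(** The projected coordinate directions are coordinate directions of the plane
or zero, and the derivative in the direction zero is the zero function. *)
Lemma smooth_on_dir (g : 'cV[R]_2 -> R) i :
  smooth_on setT g -> smooth_on setT ('D_(dir i) g).
Proof.
move=> sg; rewrite proj_pq_delta.
do 2?[case: ifP => _; first exact: smooth_on_pd].
have -> : 'D_0 g = cst 0 by apply/funext => y; rewrite /= derive0.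
exact: smooth_on_cst0.
Qed.

Lemma derivable_dir (g : 'cV[R]_2 -> R) i y :
  smooth_on setT g -> derivable g y (dir i).
Proof.
move=> sg; rewrite proj_pq_delta.
by do 2?[case: ifP => _; first exact: smooth_on_derivable sg _];
  exact: derivable0.
Qed.

Lemma is_derive_quadratic (z : 'cV[R]_8) j :
  is_derive z (delta_mx j 0)
    (fun z : 'cV[R]_8 => \sum_i weight i / 2 * z i 0 ^+ 2) (weight j * z j 0).
Proof.
have -> : (fun z : 'cV[R]_8 => \sum_i weight i / 2 * z i 0 ^+ 2)
    = \sum_i (weight i / 2) \*: ((fun z : 'cV[R]_8 => z i 0) ^+ 2).
  by apply/funext => y; rewrite fct_sumE.
apply: is_derive_eq.
  apply: is_derive_sum => i; apply: is_deriveZ; apply: is_deriveX.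
  exact: is_derive_coord.
rewrite (bigD1 j)//= eqxx big1 ?addr0 => [|i /negPf ->].
  by rewrite expr1 /GRing.scale/=; field.
by rewrite /GRing.scale/= !mulr0.
Qed.

Lemma pd_Sfun j : pd j (Sfun kappa beta V) =
  fun z => 'D_(dir j) V (proj_pq z) + weight j * z j 0.
Proof.
apply/funext => z.
have -> : Sfun kappa beta V = (V \o proj_pq)
    + (fun z : 'cV[R]_8 => \sum_i weight i / 2 * z i 0 ^+ 2).
  by apply/funext => y; exact: Sfun_quadratic.
suff [] : is_derive z (delta_mx j 0) (V \o proj_pq
    + (fun z : 'cV[R]_8 => \sum_i weight i / 2 * z i 0 ^+ 2))
    ('D_(dir j) V (proj_pq z) + weight j * z j 0) by [].
apply: is_deriveD; last exact: is_derive_quadratic.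
apply: is_derive_on_line; last exact: derivable_dir.
by move=> h; rewrite /= proj_pq_line.
Qed.

Lemma hessian_Sfun z i j : hessian (Sfun kappa beta V) z i j =
  'D_(dir i) ('D_(dir j) V) (proj_pq z) + weight j * (j == i)%:R.
Proof.
rewrite mxE pd_Sfun.
suff [] : is_derive z (delta_mx i 0) (('D_(dir j) V \o proj_pq)
    + (weight j \*: (fun z : 'cV[R]_8 => z j 0)))
    ('D_(dir i) ('D_(dir j) V) (proj_pq z) + weight j *: (j == i)%:R) by [].
apply: is_deriveD; last exact/is_deriveZ/is_derive_coord.
apply: is_derive_on_line; last exact/derivable_dir/smooth_on_dir.
by move=> h; rewrite /= proj_pq_line.
Qed.

(** The quadratic part contributes a diagonal matrix; what remains are second
derivatives of [V] in the projected directions, to which [Schwarz] applies. *)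
Lemma hessian_Sfun_sym z :
  (hessian (Sfun kappa beta V) z)^T = hessian (Sfun kappa beta V) z.
Proof.
have sV2 i j := smooth_on_dir i (smooth_on_dir j hV).
have symV i j : 'D_(dir i) ('D_(dir j) V) (proj_pq z)
    = 'D_(dir j) ('D_(dir i) V) (proj_pq z).
  apply: Schwarz.
  - by move=> y; exact: derivable_dir.
  - by move=> y; exact: derivable_dir.
  - by move=> y; exact/derivable_dir/smooth_on_dir.
  - by move=> y; exact/derivable_dir/smooth_on_dir.
  - exact: smooth_on_continuous (sV2 i j) _.
  - exact: smooth_on_continuous (sV2 j i) _.
apply/matrixP => i j.
rewrite [LHS]mxE (hessian_Sfun z j i) (hessian_Sfun z i j) (symV j i).
by rewrite eq_sym; case: eqP => [->//|]; rewrite !mulr0.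
Qed.

End Hamiltonian.

(** * The system and the equation in coordinates *)

Section System.
Context {R : realType}.
Variables (kappa beta : R).

Lemma Kmx_skew : (Kmx kappa)^T = - Kmx kappa.
Proof.
apply/matrixP => i j; rewrite !mxE.
by elim/coord8_ind: i; elim/coord8_ind: j; rewrite /= ?opprK ?oppr0.
Qed.

Lemma M1mx_skew : (M1mx beta)^T = - M1mx beta.
Proof.
apply/matrixP => i j; rewrite !mxE.
by elim/coord8_ind: i; elim/coord8_ind: j; rewrite /= ?opprK ?oppr0.
Qed.

Lemma M2mx_skew : (M2mx beta)^T = - M2mx beta.
Proof.
apply/matrixP => i j; rewrite !mxE.
by elim/coord8_ind: i; elim/coord8_ind: j; rewrite /= ?opprK ?oppr0.
Qed.

Lemma mul_Kmx (X : 'cV[R]_8) : Kmx kappa *m X = \col_i nth 0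
  [:: X jq 0 - kappa * X jphi 0; - X jp 0 - kappa * X jvarphi 0; 0; 0; 0; 0;
      kappa * X jp 0; kappa * X jq 0] i.
Proof.
apply/colP; elim/coord8_ind; rewrite !mxE sum_coord8 !mxE /=; ring.
Qed.

Lemma mul_M1mx (X : 'cV[R]_8) : M1mx beta *m X = \col_i nth 0
  [:: - beta * X jv1 0; - beta * X jw1 0; beta * X jp 0; beta * X jq 0] i.
Proof.
apply/colP; elim/coord8_ind; rewrite !mxE sum_coord8 !mxE /=; ring.
Qed.

Lemma mul_M2mx (X : 'cV[R]_8) : M2mx beta *m X = \col_i nth 0
  [:: - beta * X jv2 0; - beta * X jw2 0; 0; 0; beta * X jp 0; beta * X jq 0] i.
Proof.
apply/colP; elim/coord8_ind; rewrite !mxE sum_coord8 !mxE /=; ring.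
Qed.

Lemma omegaE (U W : 'cV[R]_8) : omega kappa U W = (U^T *m Kmx kappa *m W) 0 0.
Proof.
by rewrite -mulmxA mul_Kmx !mxE sum_coord8 !mxE /= /omega /dwedge; ring.
Qed.

Lemma k1E (U W : 'cV[R]_8) : k1 beta U W = (U^T *m M1mx beta *m W) 0 0.
Proof.
by rewrite -mulmxA mul_M1mx !mxE sum_coord8 !mxE /= /k1 /dwedge; ring.
Qed.

Lemma k2E (U W : 'cV[R]_8) : k2 beta U W = (U^T *m M2mx beta *m W) 0 0.
Proof.
by rewrite -mulmxA mul_M2mx !mxE sum_coord8 !mxE /= /k2 /dwedge; ring.
Qed.

Variables (V : 'cV[R]_2 -> R).
Hypothesis hV : smooth_on setT V.

Lemma gradient_Sfun (z : 'cV[R]_8) : gradient (Sfun kappa beta V) z = \col_i nth 0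
  [:: pd ip V (pt2 (z jp 0) (z jq 0)); pd iq V (pt2 (z jp 0) (z jq 0));
      beta * z jv1 0; beta * z jw1 0; beta * z jv2 0; beta * z jw2 0;
      kappa * z jphi 0; kappa * z jvarphi 0] i.
Proof.
apply/colP; elim/coord8_ind; rewrite !mxE pd_Sfun// proj_pq_delta /=
  /weight/= ?mul0r ?addr0 //; by rewrite derive0 add0r.
Qed.

(** [kappa] and [beta] must be nonzero for the last six rows to determine the
auxiliary components of [z]. *)
Lemma ms_rows (Xt Xx Xy z : 'cV[R]_8) : kappa != 0 -> beta != 0 ->
  Kmx kappa *m Xt + M1mx beta *m Xx + M2mx beta *m Xy
    = gradient (Sfun kappa beta V) z <->
  [/\ kappa * Xt jphi 0 - Xt jq 0 + beta * (Xx jv1 0 + Xy jv2 0)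
        + pd ip V (pt2 (z jp 0) (z jq 0)) = 0,
      kappa * Xt jvarphi 0 + Xt jp 0 + beta * (Xx jw1 0 + Xy jw2 0)
        + pd iq V (pt2 (z jp 0) (z jq 0)) = 0,
      z jv1 0 = Xx jp 0 /\ z jw1 0 = Xx jq 0,
      z jv2 0 = Xy jp 0 /\ z jw2 0 = Xy jq 0
    & z jphi 0 = Xt jp 0 /\ z jvarphi 0 = Xt jq 0].
Proof.
move=> k0 b0; rewrite mul_Kmx mul_M1mx mul_M2mx gradient_Sfun; split.
  move=> /colP eqs; have row i := eqs i.
  have := (row jp, row jq, (row jv1, row jw1), (row jv2, row jw2),
           (row jphi, row jvarphi)).
  rewrite !mxE /= ?add0r ?addr0.
  move=> [[[[e1 e2] [e3 e4]] [e5 e6]] [e7 e8]].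
  split; [lra|lra|..]; split; symmetry;
    by [exact: (mulfI b0)|exact: (mulfI k0)].
move=> [e1 e2 [e3 e4] [e5 e6] [e7 e8]].
apply/colP; elim/coord8_ind; rewrite !mxE /= ?add0r ?addr0; try lra;
  by rewrite ?e3 ?e4 ?e5 ?e6 ?e7 ?e8.
Qed.

Lemma pde_lhsE (a a' b b' c c' d d' e e' : R) :
  (kappa%:C * (a +i* a') + 'i * (b +i* b')
    + beta%:C * ((c +i* c') + (d +i* d')) + (e +i* e')
  = (kappa * a - b' + beta * (c + d) + e)
      +i* (kappa * a' + b + beta * (c' + d') + e'))%C.
Proof.
by apply/eqP; rewrite eq_complex /=; apply/andP; split; apply/eqP; ring.
Qed.

(** Real and imaginary parts of the wave equation at a point. *)
Definition real_wave_system (p q : 'cV[R]_3 -> R) (P : 'cV[R]_3) : Prop :=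
  kappa * pd it (pd it p) P - pd it q P
    + beta * (pd ix (pd ix p) P + pd iy (pd iy p) P)
    + pd ip V (pt2 (p P) (q P)) = 0 /\
  kappa * pd it (pd it q) P + pd it p P
    + beta * (pd ix (pd ix q) P + pd iy (pd iy q) P)
    + pd iq V (pt2 (p P) (q P)) = 0.

Lemma solves_pde_real (f : R[i] -> R[i]) (A : set 'cV[R]_3) u :
  (forall p q : R, complex.Re (f (p +i* q)%C) = pd ip V (pt2 p q)) ->
  (forall p q : R, complex.Im (f (p +i* q)%C) = pd iq V (pt2 p q)) ->
  solves_pde kappa beta f A u <-> forall P, A P ->
    real_wave_system (fun P => complex.Re (u P)) (fun P => complex.Im (u P)) P.
Proof.
move=> hRe hIm.
pose p P := complex.Re (u P); pose q P := complex.Im (u P).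
suff pdeE P : (kappa%:C * cpd it (cpd it u) P + 'i * cpd it u P
     + beta%:C * (cpd ix (cpd ix u) P + cpd iy (cpd iy u) P) + f (u P))%C
  = ((kappa * pd it (pd it p) P - pd it q P
      + beta * (pd ix (pd ix p) P + pd iy (pd iy p) P)
      + pd ip V (pt2 (p P) (q P))) +i*
    (kappa * pd it (pd it q) P + pd it p P
      + beta * (pd ix (pd ix q) P + pd iy (pd iy q) P)
      + pd iq V (pt2 (p P) (q P))))%C.
  split=> H P AP; first by have := etrans (esym (pdeE P)) (H P AP); case.
  have [re0 im0] := H P AP.
  exact: etrans (pdeE P) (congr2 (@Complex R) re0 im0).
have -> : f (u P) = (pd ip V (pt2 (p P) (q P)) +i* pd iq V (pt2 (p P) (q P)))%C.
  by rewrite -hRe -hIm /p /q; case: (u P) => a b /=; case: (f _).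
exact: pde_lhsE (pd it (pd it p) P) (pd it (pd it q) P) (pd it p P) (pd it q P)
  (pd ix (pd ix p) P) (pd ix (pd ix q) P) (pd iy (pd iy p) P)
  (pd iy (pd iy q) P) _ _.
Qed.

End System.

(** * Equivalence of the equation and the system *)

Section Equivalence.
Context {R : realType}.
Implicit Types (A : set 'cV[R]_3) (u : 'cV[R]_3 -> R[i]).

Lemma zlift_coords u :
  let p P := complex.Re (u P) in
  let q P := complex.Im (u P) in
  [/\ (fun P => zlift u P jp 0) = p /\ (fun P => zlift u P jq 0) = q,
      (fun P => zlift u P jv1 0) = pd ix p /\ (fun P => zlift u P jw1 0) = pd ix q,
      (fun P => zlift u P jv2 0) = pd iy p /\ (fun P => zlift u P jw2 0) = pd iy q
    & (fun P => zlift u P jphi 0) = pd it p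
      /\ (fun P => zlift u P jvarphi 0) = pd it q].
Proof. by split; split; apply/funext => P; rewrite mxE. Qed.

Lemma derivable_zlift A u P i : csmooth_on A u -> A P ->
  derivable (zlift u) P (delta_mx i 0).
Proof.
move=> [sp sq] AP; apply/derivable_mxP => j k'; rewrite (ord1 k') {k'}.
have [[zp zq] [zv1 zw1] [zv2 zw2] [zphi zvarphi]] := zlift_coords u.
have dp k := smooth_on_derivable (i := i) (smooth_on_pd k sp) AP.
have dq k := smooth_on_derivable (i := i) (smooth_on_pd k sq) AP.
elim/coord8_ind: j.
- by rewrite zp; exact: (smooth_on_derivable (i := i) sp AP).
- by rewrite zq; exact: (smooth_on_derivable (i := i) sq AP).
- by rewrite zv1; exact: dp.
- by rewrite zw1; exact: dq.
- by rewrite zv2; exact: dp.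
- by rewrite zw2; exact: dq.
- by rewrite zphi; exact: dp.
- by rewrite zvarphi; exact: dq.
Qed.

Variables (kappa beta : R) (V : 'cV[R]_2 -> R) (f : R[i] -> R[i]).
Hypotheses (kappa0 : kappa != 0) (beta0 : beta != 0).
Hypothesis hV : smooth_on setT V.
Hypothesis hRe : forall p q : R, complex.Re (f (p +i* q)%C) = pd ip V (pt2 p q).
Hypothesis hIm : forall p q : R, complex.Im (f (p +i* q)%C) = pd iq V (pt2 p q).

Local Notation ms :=
  (solves_ms (Kmx kappa) (M1mx beta) (M2mx beta) (Sfun kappa beta V)).

Lemma pde_iff_ms A u : csmooth_on A u ->
  solves_pde kappa beta f A u <-> ms A (zlift u).
Proof.
move=> su; have pdeP := solves_pde_real kappa beta A u hRe hIm.
have [[zp zq] [zv1 zw1] [zv2 zw2] [zphi zvarphi]] := zlift_coords u.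
suff rowsP P : A P -> (Kmx kappa *m pd it (zlift u) P
      + M1mx beta *m pd ix (zlift u) P + M2mx beta *m pd iy (zlift u) P
      = gradient (Sfun kappa beta V) (zlift u P) <->
    real_wave_system kappa beta V (fun P => complex.Re (u P))
      (fun P => complex.Im (u P)) P).
  split=> [/pdeP pde P AP|msz]; first exact: (rowsP P AP).2 (pde P AP).
  by apply/pdeP => P AP; exact: (rowsP P AP).1 (msz P AP).
move=> AP.
have zE i j g : (fun Q => zlift u Q j 0) = g -> pd i (zlift u) P j 0 = pd i g P.
  by move=> <-; apply: pd_coord; exact: derivable_zlift su AP.
have := (zE it _ _ zp, zE it _ _ zq, zE it _ _ zphi, zE it _ _ zvarphi).
have := (zE ix _ _ zp, zE ix _ _ zq, zE ix _ _ zv1, zE ix _ _ zw1).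
have := (zE iy _ _ zp, zE iy _ _ zq, zE iy _ _ zv2, zE iy _ _ zw2).
(* Only the listed coordinates of the three derivatives matter; as variables they
   keep the rewriting below from comparing limits by unfolding. *)
generalize (pd it (zlift u) P) (pd ix (zlift u) P) (pd iy (zlift u) P).
move=> Xt Xx Xy yE xE tE.
apply: (iff_trans (ms_rows hV Xt Xx Xy _ kappa0 beta0)).
rewrite !yE !xE !tE !mxE /=.
split=> [[re0 im0 _ _ _]|[re0 im0]]; first exact: conj re0 im0.
by split; [exact: re0|exact: im0|..].
Qed.

Lemma eq_on_ms A z1 z2 : open A -> (forall P, A P -> z1 P = z2 P) ->
  ms A z1 -> ms A z2.
Proof.
move=> oA z12 msz P AP.
by rewrite -(z12 P AP) -!(eq_on_pd _ oA AP z12); exact: msz.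
Qed.

(** The last six rows of the system, which hold on [A] only, are the definition of
the lift. *)
Lemma ms_eq_zlift A z : open A -> smooth_on A z -> ms A z ->
  let u P := (z P jp 0 +i* z P jq 0)%C in
  forall P, A P -> z P = zlift u P.
Proof.
move=> oA sz msz u P AP.
have zE i j : pd i z P j 0 = pd i (fun Q => z Q j 0) P.
  exact/pd_coord/smooth_on_derivable/AP.
have [_ _ [v1E w1E] [v2E w2E] [phiE varphiE]] :=
  (ms_rows hV _ _ _ _ kappa0 beta0).1 (msz P AP).
apply/colP; elim/coord8_ind; rewrite mxE.
- by [].
- by [].
- exact: etrans v1E (zE ix jp).
- exact: etrans w1E (zE ix jq).
- exact: etrans v2E (zE iy jp).
- exact: etrans w2E (zE iy jq).
- exact: etrans phiE (zE it jp).
- exact: etrans varphiE (zE it jq).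
Qed.

End Equivalence.

Theorem mainTheorem7 (R : realType) (kappa beta : R) (hkappa : 0 < kappa)
    (hbeta : 0 < beta) (V : 'cV[R]_2 -> R) (hV : smooth_on setT V)
    (f : R[i] -> R[i])
    (hRe : forall p q : R, complex.Re (f (p +i* q)%C) = pd ip V (pt2 p q))
    (hIm : forall p q : R, complex.Im (f (p +i* q)%C) = pd iq V (pt2 p q))
    (A : set 'cV[R]_3) (hA : open A) :
  let K := Kmx kappa in
  let M1 := M1mx beta in
  let M2 := M2mx beta in
  let S := Sfun kappa beta V in
  [/\ [/\ K^T = - K, M1^T = - M1 & M2^T = - M2],
      forall u : 'cV[R]_3 -> R[i], csmooth_on A u ->
        (solves_pde kappa beta f A u <-> solves_ms K M1 M2 S A (zlift u)),
      forall z : 'cV[R]_3 -> 'cV[R]_8, smooth_on A z ->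
        (solves_ms K M1 M2 S A z <->
         exists u : 'cV[R]_3 -> R[i],
           [/\ csmooth_on A u, solves_pde kappa beta f A u
             & forall P, A P -> z P = zlift u P])
    & forall z U W : 'cV[R]_3 -> 'cV[R]_8,
        smooth_on A z -> smooth_on A U -> smooth_on A W ->
        solves_ms K M1 M2 S A z ->
        solves_variational K M1 M2 S A z U ->
        solves_variational K M1 M2 S A z W ->
        forall P, A P ->
          pd it (fun Q => omega kappa (U Q) (W Q)) P
          + pd ix (fun Q => k1 beta (U Q) (W Q)) P
          + pd iy (fun Q => k2 beta (U Q) (W Q)) P = 0].
Proof.
move=> K M1 M2 S; have kappa0 := lt0r_neq0 hkappa; have beta0 := lt0r_neq0 hbeta.
have pde_ms u (su : csmooth_on A u) :=
  pde_iff_ms kappa0 beta0 hV hRe hIm su.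
split.
- by split; [exact: Kmx_skew|exact: M1mx_skew|exact: M2mx_skew].
- exact: pde_ms.
- move=> z sz; split=> [msz|[u [su pdeu zu]]]; last first.
    apply: (eq_on_ms hA (fun P AP => esym (zu P AP))).
    exact/(pde_ms u su).
  have zu := ms_eq_zlift kappa0 beta0 hV hA sz msz.
  exists (fun P => (z P jp 0 +i* z P jq 0)%C).
  have su : csmooth_on A (fun P => (z P jp 0 +i* z P jq 0)%C).
    by split; exact: smooth_on_coord.
  by split=> //; apply/(pde_ms _ su); exact: eq_on_ms msz.
- move=> z U W _ sU sW _ varU varW P AP.
  pose M i := if i == it then K else if i == ix then M1 else M2.
  have MU X : K *m pd it X P + M1 *m pd ix X P + M2 *m pd iy X P
      = \sum_i M i *m pd i X P.
    by rewrite sum_coord3 /M/= [RHS]addrC addrA.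
  have skewM i : (M i)^T = - M i.
    rewrite /M; do 2?case: ifP => _;
    by [exact: Kmx_skew|exact: M1mx_skew|exact: M2mx_skew].
  have := multisymplectic_conservation skewM (hessian_Sfun_sym kappa beta hV (z P))
    (fun i => smooth_on_derivable (i := i) sU AP)
    (fun i => smooth_on_derivable (i := i) sW AP).
  rewrite -!MU => /(_ (varU P AP) (varW P AP)).
  rewrite sum_coord3 /M/= => conservation.
  have omegaWE : (fun Q => omega kappa (U Q) (W Q))
      = fun Q => ((U Q)^T *m K *m W Q) 0 0 by apply/funext => Q; exact: omegaE.
  have k1WE : (fun Q => k1 beta (U Q) (W Q))
      = fun Q => ((U Q)^T *m M1 *m W Q) 0 0 by apply/funext => Q; exact: k1E.
  have k2WE : (fun Q => k2 beta (U Q) (W Q))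
      = fun Q => ((U Q)^T *m M2 *m W Q) 0 0 by apply/funext => Q; exact: k2E.
  by rewrite omegaWE k1WE k2WE -addrA addrC; exact: conservation.
Qed.
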